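(* Let $H$ be a complex Hilbert space and let $\varphi:\mathscr{B}(H)\to\mathscr{B}(H)$ be a completely positive map. Define $K:(\mathscr{B}(H)\times H)\times(\mathscr{B}(H)\times H)\to\mathbb{C}$ by $$K\big((S,a),(T,b)\big):=\langle a,\varphi(S^{*}T)b\rangle .$$ Then $K$ is a positive definite kernel. Let $H_K$ be its reproducing kernel Hilbert space, with kernel sections $K_{(T,b)}=K(\cdot,(T,b))$. There exists a minimal Stinespring dilation $(\pi,H_K,V)$ of $\varphi$, i.e. $$\varphi(S)=V^{*}\pi(S)V\qquad\text{for all } S\in\mathscr{B}(H),$$ where: 1. the dilation space $H_K$ is the reproducing kernel Hilbert space of $K$; 2. $V:H\to H_K$ is the bounded linear operator given by $Vb:=K_{(I,b)}=K(\cdot,(I,b))$ for $b\in H$; 3. $\pi:\mathscr{B}(H)\to\mathscr{B}(H_K)$ is the unital $*$-representation determined on the kernel sections (whose linear span is dense) by $\pi(S)K_{(T,b)}:=K_{(ST,b)}$ for $S,T\in\mathscr{B}(H)$, $b\in H$.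
   Context: All inner products are linear in the second variable. $\mathscr{B}(H)$ is the algebra of bounded operators on $H$ and $I$ is the identity. A function $K:X\times X\to\mathbb{C}$ is a positive definite kernel if $\sum_{i,j}\overline{c_i}c_jK(x_i,x_j)\ge 0$ for all finite families $x_i\in X$, $c_i\in\mathbb{C}$. Its reproducing kernel Hilbert space (RKHS) is the Hilbert space of functions on $X$ in which the sections $K_x:=K(\cdot,x)$ have dense linear span and $u(x)=\langle K_x,u\rangle$ for every $u$; in particular $\langle K_x,K_y\rangle=K(x,y)$. The dilation $(\pi,H_K,V)$ is minimal if the closed linear span of $\{\pi(S)Vb: S\in\mathscr{B}(H),\ b\in H\}$ is $H_K$. *)

(* Defs.v *)
From HB Require Import structures.
From mathcomp Require Import all_boot all_order all_algebra.
From mathcomp Require Import sesquilinear complex.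
From mathcomp Require Import boolp classical_sets functions reals.
From mathcomp Require Import topology normedtype.

Set Implicit Arguments.
Unset Strict Implicit.
Unset Printing Implicit Defensive.

Import Order.TTheory GRing.Theory Num.Theory.
Import numFieldNormedType.Exports.

Local Open Scope classical_set_scope.
Local Open Scope ring_scope.
Local Open Scope complex_scope.

(* A complex Hilbert space is a complete normed module over [R[i]] whose norm
   comes from an inner product.  Norms of a normed module over [R[i]] are
   themselves elements of [R[i]] (real and nonnegative).  MathComp's [{dot _}]
   is linear in its first argument, hence the swap in [inner] below. *)
HB.mixin Record CompleteNormedModule_isHilbert (R : realType) V
    & CompleteNormedModule R[i] V := {
  hdot : {dot V for Num.conj};
  hdot_norm : forall u : V, hdot u u = `|u| ^+ 2;
}.

#[short(type="hilbertType")]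
HB.structure Definition Hilbert (R : realType) :=
  {V of CompleteNormedModule R[i] V & CompleteNormedModule_isHilbert R V}.

(* Antilinear in [u], linear in [v]. *)
Definition inner (R : realType) (H : hilbertType R) (u v : H) : R[i] :=
  hdot v u.

Section BoundedOperators.
Variables (R : realType) (H1 H2 : hilbertType R).

Definition is_bounded_op : {pred (H1 -> H2)} := fun f =>
  `[< linear f /\ exists M : R[i], forall u, `|f u| <= M * `|u| >].

Record bop := Bop { bop_fun :> H1 -> H2; _ : bop_fun \in is_bounded_op }.

HB.instance Definition _ := [isSub for bop_fun].
HB.instance Definition _ := [Choice of bop by <:].

Lemma is_bounded_op_submod : submod_closed is_bounded_op.
Proof.
split.
  apply/asboolP; split; first by move=> a u v; rewrite /= scaler0 addr0.
  by exists 0 => u; rewrite normr0 mul0r.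
move=> a f g /asboolP[lf [M Mf]] /asboolP[lg [N Ng]]; apply/asboolP; split.
  move=> c u v; have -> w : (a *: f + g) w = a *: f w + g w by [].
  by rewrite lf lg !scalerDr !scalerA mulrC addrACA.
exists (`|a| * M + N) => u; have -> : (a *: f + g) u = a *: f u + g u by [].
rewrite mulrDl (le_trans (ler_normD _ _))// lerD// normrZ -mulrA.
by rewrite ler_wpM2l.
Qed.

HB.instance Definition _ := GRing.isSubmodClosed.Build R[i] (H1 -> H2)
  is_bounded_op is_bounded_op_submod.
HB.instance Definition _ := [SubChoice_isSubLmodule of bop by <:].

Lemma bop_linear (S : bop) : linear S.
Proof. by case: S => f /= /asboolP[]. Qed.

HB.instance Definition _ (S : bop) :=
  GRing.isLinear.Build R[i] H1 H2 *:%R S (bop_linear S).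

Lemma bop_bounded (S : bop) :
  exists2 M : R[i], 0 <= M & forall u, `|S u| <= M * `|u|.
Proof.
case: S => f /= /asboolP[_ [M Mf]]; exists `|M| => // u.
have Mu0 : 0 <= M * `|u| by exact: le_trans (normr_ge0 _) (Mf u).
by rewrite -[X in _ * X]normr_id -normrM (ger0_norm Mu0).
Qed.

End BoundedOperators.

Notation "''B' ( H )" := (bop H H) (format "''B' ( H )") : type_scope.

Section Composition.
Variables (R : realType) (H1 H2 H3 : hilbertType R).

Lemma comp_is_bounded_op (S : bop H2 H3) (T : bop H1 H2) :
  S \o T \in @is_bounded_op R H1 H3.
Proof.
apply/asboolP; split; first by move=> a u v; rewrite /= !linearP.
have [M M0 MS] := bop_bounded S; have [N _ NT] := bop_bounded T.
exists (M * N) => u /=.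
by rewrite (le_trans (MS _))// -mulrA ler_wpM2l.
Qed.

Definition bcomp (S : bop H2 H3) (T : bop H1 H2) : bop H1 H3 :=
  Bop (comp_is_bounded_op S T).

End Composition.

Section OperatorAlgebra.
Variables (R : realType) (H : hilbertType R).
Implicit Types S T U : 'B(H).

Lemma id_is_bounded_op : id \in @is_bounded_op R H H.
Proof.
by apply/asboolP; split=> //; exists 1 => u; rewrite mul1r.
Qed.

Definition bid : 'B(H) := Bop id_is_bounded_op.

Let bcompA : associative (@bcomp R H H H).
Proof. by move=> S T U; apply/val_inj. Qed.
Let bcomp1o : left_id bid (@bcomp R H H H).
Proof. by move=> S; apply/val_inj. Qed.
Let bcompo1 : right_id bid (@bcomp R H H H).
Proof. by move=> S; apply/val_inj. Qed.
Let bcompDl : left_distributive (@bcomp R H H H) +%R.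
Proof. by move=> S T U; apply/val_inj. Qed.
Let bcompDr : right_distributive (@bcomp R H H H) +%R.
Proof. by move=> S T U; apply/val_inj/funext => u; rewrite /= linearD. Qed.

(* Only a [pzRingType]: when [H] is the zero space, [1 = 0] in ['B(H)]. *)
HB.instance Definition _ := GRing.Zmodule_isPzRing.Build 'B(H)
  bcompA bcomp1o bcompo1 bcompDl bcompDr.

End OperatorAlgebra.

(* The Hilbert space adjoint of [S].  By the Riesz representation theorem the
   set below is a singleton for every [S], so that the default value [0] is
   never returned. *)
Definition adjoint (R : realType) (H1 H2 : hilbertType R) (S : bop H1 H2) :
    bop H2 H1 :=
  xget (0 : bop H2 H1)
    [set T : bop H2 H1 | forall u v, inner u (S v) = inner (T u) v].

(* [A : 'M['B(H)]_n] acts on the Hilbert direct sum of [n] copies of [H] by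
   [(A h)_i = \sum_j A i j (h j)]; it is positive when [<h, A h> >= 0] for
   every [h] in that sum. *)
Definition mx_op_positive (R : realType) (H : hilbertType R) (n : nat)
    (A : 'M['B(H)]_n) : Prop :=
  forall h : 'I_n -> H, 0 <= \sum_i inner (h i) (\sum_j A i j (h j)).

Definition completely_positive (R : realType) (H1 H2 : hilbertType R)
    (phi : 'B(H1) -> 'B(H2)) : Prop :=
  forall (n : nat) (A : 'M['B(H1)]_n),
    mx_op_positive A -> mx_op_positive (map_mx phi A).

Definition positive_definite_kernel (R : realType) (X : Type)
    (K : X -> X -> R[i]) : Prop :=
  forall (n : nat) (x : 'I_n -> X) (c : 'I_n -> R[i]),
    0 <= \sum_i \sum_j Num.conj (c i) * c j * K (x i) (x j).

Definition lin_span (R : realType) (V : lmodType R[i]) (A : set V) : set V :=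
  [set v | exists (n : nat) (c : 'I_n -> R[i]) (a : 'I_n -> V),
    (forall i, A (a i)) /\ v = \sum_i c i *: a i].

(* A reproducing kernel Hilbert space of [K]: a Hilbert space identified,
   through the injective linear map [rkhs_fun], with a space of functions on
   [X].  [ksection x] is the vector whose underlying function is [K(., x)]. *)
Record rkhs (R : realType) (X : Type) (K : X -> X -> R[i]) := Rkhs {
  rkhs_space :> hilbertType R;
  rkhs_fun : rkhs_space -> X -> R[i];
  rkhs_fun_linear : forall x, scalar (rkhs_fun^~ x);
  rkhs_fun_inj : injective rkhs_fun;
  ksection : X -> rkhs_space;
  ksection_fun : forall x, rkhs_fun (ksection x) = K ^~ x;
  ksection_dense : closure (lin_span (range ksection)) = [set: rkhs_space];
  reproducing : forall u x, rkhs_fun u x = inner (ksection x) u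
}.

Definition dilation_kernel (R : realType) (H : hilbertType R)
    (phi : 'B(H) -> 'B(H)) (x y : 'B(H) * H) : R[i] :=
  inner x.2 (phi (adjoint x.1 * y.1) y.2).

Definition unital_star_representation (R : realType) (H1 H2 : hilbertType R)
    (pi : 'B(H1) -> 'B(H2)) : Prop :=
  [/\ linear pi, pi 1 = 1, {morph pi : S T / S * T}
    & {morph pi : S / adjoint S}].

(* [(pi, H2, V)] is a minimal Stinespring dilation of [phi]. *)
Definition minimal_stinespring_dilation (R : realType) (H1 H2 : hilbertType R)
    (phi : 'B(H1) -> 'B(H1)) (pi : 'B(H1) -> 'B(H2)) (V : bop H1 H2) : Prop :=
  [/\ unital_star_representation pi,
      forall S, phi S = bcomp (adjoint V) (bcomp (pi S) V)
    & closure (lin_span [set pi S (V b) | S in [set: 'B(H1)] & b in [set: H1]])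
      = [set: H2]].

(* Main.v *)
From HB Require Import structures.
Require Import Defs.
From mathcomp Require Import all_boot all_order all_algebra.
From mathcomp Require Import complex reals.
From mathcomp Require Import sesquilinear boolp classical_sets functions.
From mathcomp Require Import topology normedtype sequences.
From mathcomp Require Import ring lra interval_inference.

(** The space [H_K] is realised as the completion of the span of the sections
[K(., x)].  On any such space, complete positivity applied to the operator
matrix [T_i^* (M^2 - S^* S) T_j], which is positive when [|S u| <= M |u|],
bounds the Gram form of the sections at [(S T_i, b_i)] by [M^2] times that of
the sections at [(T_i, b_i)].  Hence [K_(T, b) |-> K_(S T, b)] extends by
density to a bounded operator [pi S]; the algebraic identities hold on sections
and propagate by density, and [<V a, pi S (V b)> = K ((1, a), (S, b))] is
[<a, phi S b>]. *)

Set Implicit Arguments.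
Unset Strict Implicit.
Unset Printing Implicit Defensive.

Import Order.TTheory GRing.Theory Num.Theory.
Import numFieldNormedType.Exports.

Local Open Scope classical_set_scope.
Local Open Scope ring_scope.
Local Open Scope complex_scope.

(** * Hermitian forms *)

(** Sections at different points may be linearly dependent, so a map prescribed on them extends to
    their span only if it respects every linear relation. The Gram inequality settles this together
    with continuity, since a combination of norm zero is sent to one of norm zero. Combinations of
    [n] sections are what calls for positivity of [n] by [n] operator matrices rather than of [phi]
    alone. [adjoint] is a chosen value with default [0], so the identity that every computation with
    [K] relies on has to come from the Riesz theorem. Norms lie in [R[i]], whose order is partial,
    so infima and limits are first found in [R]. *)

Section HermitianForms.
Variables (C : numClosedFieldType) (U : lmodType C).
Implicit Types f : {hermitian U for false & Num.conj}.

Lemma herm_conj f u v : f v u = (f u v)^*%R.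
Proof. by rewrite hermC expr0 mul1r. Qed.

(** Only semidefiniteness is assumed, because [kdot_gt0] derives definiteness from this inequality.
    The degenerate case [f v v = 0] therefore needs its own argument. *)
Lemma psd_form_CauchySchwarz f (f_ge0 : forall u, 0 <= f u u) u v :
  `|f u v| ^+ 2 <= f u u * f v v.
Proof.
have normE a b : f (a *: u - b *: v) (a *: u - b *: v) =
    a * a^*%R * f u u - a * b^*%R * f u v - b * a^*%R * (f u v)^*%R
    + b * b^*%R * f v v.
  rewrite linearBl !linearBr !linearZl_LR !linearZr_LR/= (herm_conj f u v).
  ring.
have fvv := f_ge0 v; have fuu := f_ge0 u.
have [fvv0|fvvN0] := eqVneq (f v v) 0.
  rewrite fvv0 mulr0; have [->|fuvN0] := eqVneq (f u v) 0.
    by rewrite normr0 expr0n.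
  have n0 : 0 < `|f u v| ^+ 2 by rewrite exprn_gt0 // normr_gt0.
  (* When [f v v = 0], the form at [u - t f(u, v) v] equals [f u u - 2 t |f u v|^2]; this [t] makes
     it [-1]. *)
  pose t := (f u u + 1) / (2 * `|f u v| ^+ 2).
  have t_real : t^*%R = t.
    by apply: CrealP; rewrite rpredM ?rpredV ?rpredD ?rpredM ?ger0_real// ltW.
  have := f_ge0 (1 *: u - (t * f u v) *: v).
  rewrite normE fvv0 conjC1 rmorphM /= t_real.
  have -> : 1 * 1 * f u u - 1 * (t * (f u v)^*%R) * f u v -
     t * f u v * 1 * (f u v)^*%R + t * f u v * (t * (f u v)^*%R) * 0 =
     f u u - 2 * t * `|f u v| ^+ 2 by rewrite normCK; ring.
  have -> : f u u - 2 * t * `|f u v| ^+ 2 = -1.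
    by rewrite /t; field; rewrite normr_eq0.
  by rewrite oppr_ge0 ler10.
have fvv_gt0 : 0 < f v v by rewrite lt_def fvvN0.
(* The component of [u] orthogonal to [v], scaled by [f v v] to avoid a division. *)
have := f_ge0 (f v v *: u - f u v *: v).
rewrite normE (CrealP (ger0_real fvv)).
have -> : f v v * f v v * f u u - f v v * (f u v)^*%R * f u v -
    f u v * f v v * (f u v)^*%R + f u v * (f u v)^*%R * f v v =
    f v v * (f u u * f v v - `|f u v| ^+ 2) by rewrite normCK; ring.
by rewrite pmulr_rge0// subr_ge0.
Qed.

End HermitianForms.

Lemma addC_conj_le (C : numClosedFieldType) (x : C) : x + x^*%R <= 2 * `|x|.
Proof.
have xR : x + x^*%R \is Num.real by rewrite CrealE rmorphD/= conjCK addrC.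
rewrite (le_trans (real_ler_norm xR))// (le_trans (ler_normD _ _))//.
by rewrite norm_conjC -mulr2n -[leLHS]mulr_natl.
Qed.

Section DotLength.
Variables (C : numClosedFieldType) (V : lmodType C) (d : {dot V for Num.conj}).
Implicit Types u v : V.

Lemma dot_ge0 u : 0 <= d u u.
Proof.
have [->|u0] := eqVneq u 0; first by rewrite linear0l.
by rewrite ltW// neq0_dnorm_gt0.
Qed.

Definition dlen u := sqrtC (d u u).

Lemma dlen_ge0 u : 0 <= dlen u. Proof. by rewrite sqrtC_ge0 dot_ge0. Qed.

Lemma dlen_sqr u : dlen u ^+ 2 = d u u. Proof. exact: sqrtCK. Qed.

Lemma dlen_CauchySchwarz u v : `|d u v| <= dlen u * dlen v.
Proof.
rewrite -(ler_pXn2r (n := 2)) ?nnegrE ?mulr_ge0 ?dlen_ge0// exprMn !dlen_sqr.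
exact: psd_form_CauchySchwarz dot_ge0 _ _.
Qed.

Lemma dlenD u v : dlen (u + v) <= dlen u + dlen v.
Proof.
rewrite -(ler_pXn2r (n := 2)) ?nnegrE ?addr_ge0 ?dlen_ge0// dlen_sqr.
rewrite (_ : d (u + v) _ = d u u + d v v + (d u v + (d u v)^*%R)); last first.
  by rewrite linearDl !linearDr/= (herm_conj d u v); ring.
rewrite sqrrD !dlen_sqr [leRHS]addrAC lerD2l.
rewrite (le_trans (addC_conj_le _))// -[leRHS]mulr_natl ler_pM2l//.
exact: dlen_CauchySchwarz.
Qed.

Lemma dlenZ a u : dlen (a *: u) = `|a| * dlen u.
Proof.
rewrite /dlen linearZl_LR linearZr_LR/= mulrA -normCK.
by rewrite sqrtCM ?nnegrE ?exprn_ge0 ?dot_ge0// sqrCK.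
Qed.

Lemma dlen_eq0 u : dlen u = 0 -> u = 0.
Proof.
move=> /eqP; rewrite sqrtC_eq0 => u0; apply/eqP; apply: contraTT u0 => u0.
by rewrite gt_eqF// neq0_dnorm_gt0.
Qed.

Lemma dlenN u : dlen (- u) = dlen u.
Proof. by rewrite -scaleN1r dlenZ normrN1 mul1r. Qed.

Lemma dlen0 : dlen 0 = 0.
Proof. by rewrite -(scale0r 0) dlenZ normr0 mul0r. Qed.

End DotLength.

(** * Limits in normed modules and in the complex numbers *)

(** A positive complex number is real, so the Archimedean property is inherited from [R]. *)
Lemma near_infty_complex_natSinv_lt (R : realType) (e : R[i]) : 0 < e ->
  \forall n \near \oo, (n.+1%:R^-1 : R[i]) < e.
Proof.
rewrite ltcE/= => /andP[/eqP Ie Re0].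
have := near_infty_natSinv_lt (PosNum Re0).
apply: filterS => n /= ltne.
have -> : n.+1%:R^-1 = (n.+1%:R^-1 : R)%:C by rewrite fmorphV/= rmorph_nat.
by rewrite ltcE/= Ie eqxx.
Qed.

Section NormedModules.
Variables (K : numFieldType) (V : normedModType K).

Lemma closure_normP (A : set V) u :
  closure A u <-> forall e, 0 < e -> exists2 a, A a & `|u - a| < e.
Proof.
split=> [Au e e0|Au B].
  have [a [Aa]] := Au _ (nbhsx_ballx u e e0).
  by rewrite -ball_normE/=; exists a.
rewrite -nbhs_ballE/= => -[e e0 eB]; have [a Aa ua] := Au e e0.
by exists a; split => //; apply: eB; rewrite -ball_normE.
Qed.

Lemma cauchy_seqP (u : nat -> V) :
  cauchy (u @ \oo) <-> forall e, 0 < e ->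
    exists N, forall m n, (N <= m)%N -> (N <= n)%N -> `|u m - u n| <= e.
Proof.
split=> [/cauchyP uc e e0|uc].
  have [|x [N _ Nx]] := uc (e / 2); first by rewrite divr_gt0.
  exists N => m n Nm Nn.
  have := Nx _ Nn; have := Nx _ Nm.
  rewrite /= -ball_normE/= => xm xn.
  rewrite (splitr e) (le_trans (ler_distD x _ _))// lerD// ltW//.
  by rewrite distrC.
apply/cauchyP => e e0; have [|N Nu] := uc (e / 2); first by rewrite divr_gt0.
exists (u N); exists N => // n Nn; rewrite /= -ball_normE/=.
by rewrite (le_lt_trans (Nu _ _ _ _))// gtr_pMr// invf_lt1// ltr1n.
Qed.

End NormedModules.

Section ComplexSequences.
Variable R : realType.
Implicit Types (x : nat -> R[i]) (l : R[i]).

Lemma normc_ge_Im (z : R[i]) : `|complex.Im z|%:C <= `|z|.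
Proof.
have := normc_ge_Re (z * 'i%C); rewrite ReiNIm normrN normrM.
by rewrite [`|'i%C|]normc_def/= expr0n expr1n add0r sqrtr1 mulr1.
Qed.

Lemma normc_le_ReIm (z : R[i]) :
  `|z| <= (`|complex.Re z| + `|complex.Im z|)%:C.
Proof.
rewrite {1}[z]complexE (le_trans (ler_normD _ _))// rmorphD/= normrM.
rewrite [`|'i%C|]normc_def/= expr0n expr1n add0r sqrtr1 mul1r.
by rewrite !normc_def/= expr0n !addr0 !sqrtr_sqr.
Qed.

Lemma cvg_complexP x l : x @ \oo --> (l : R[i]^o) <->
  forall e, 0 < e -> \forall n \near \oo, `|l - x n| <= e.
Proof. exact: (@cvgrPdist_le _ R[i]^o). Qed.

(** Completeness of [R] is transported through [Re] and [Im], which are additive and do not increase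
    the modulus; [P] below stands for either. *)
Lemma complex_cauchy_cvg x :
  (forall e, 0 < e ->
    exists N, forall m n, (N <= m)%N -> (N <= n)%N -> `|x m - x n| <= e) ->
  exists l, x @ \oo --> (l : R[i]^o).
Proof.
move=> xc.
have part_cvg (P : R[i] -> R) : (forall z w, P (z - w) = P z - P w) ->
    (forall z, `|P z|%:C <= `|z|) -> exists a : R, P \o x @ \oo --> a.
  move=> PB Pz; apply/cvg_ex; apply: R_complete; apply/cauchy_seqP => e e0.
  have [|N xN] := xc e%:C; first by rewrite ltcR.
  exists N => m n Nm Nn; rewrite /= -PB -lecR.
  exact: le_trans (Pz _) (xN _ _ Nm Nn).
have [|a xa] := part_cvg (@complex.Re R) _ (@normc_ge_Re R).
  by case=> ? ? [].
have [|b xb] := part_cvg (@complex.Im R) _ normc_ge_Im.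
  by case=> ? ? [].
exists (a +i* b); apply/cvg_complexP => e.
rewrite ltcE/= => /andP[/eqP Ie Re0].
have eE : e = (complex.Re e)%:C by apply/eqP; rewrite eq_complex/= Ie !eqxx.
have e2 : 0 < complex.Re e / 2 by rewrite divr_gt0.
move/cvgrPdist_le : xa => /(_ _ e2); move/cvgrPdist_le : xb => /(_ _ e2).
apply: filterS2 => n /= xb xa.
rewrite (le_trans (normc_le_ReIm _))// eE lecR (splitr (complex.Re e)).
by case: (x n) xa xb => ? ? /= xa xb; rewrite lerD.
Qed.

Lemma cvg_conj x l : x @ \oo --> (l : R[i]^o) ->
  (x n)^*%R @[n --> \oo] --> (l^*%R : R[i]^o).
Proof.
move=> xl; apply/cvg_complexP => e e0; move/cvg_complexP : xl => /(_ _ e0).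
by apply: filterS => n; rewrite -rmorphB norm_conjC.
Qed.

Lemma eq_cvg_complex x y l : x =1 y ->
  x @ \oo --> (l : R[i]^o) -> y @ \oo --> (l : R[i]^o).
Proof. by move=> /funext ->. Qed.

Lemma cvg_complex_unique x l m :
  x @ \oo --> (l : R[i]^o) -> x @ \oo --> (m : R[i]^o) -> l = m.
Proof.
by move=> xl xm; exact: (cvg_unique (@norm_hausdorff _ R[i]^o) xl xm).
Qed.

Lemma cvg_complex_ge0 x l : x @ \oo --> (l : R[i]^o) ->
  (\forall n \near \oo, 0 <= x n) -> 0 <= l.
Proof.
(* Nonnegativity means being equal to one's modulus, and this equality passes to the limit. *)
move=> xl x0; suff -> : l = `|l| by [].
apply: (cvg_complex_unique xl); apply/cvg_complexP => e e0.
move/cvg_complexP : xl => /(_ _ e0); apply: filterS2 x0 => n xn0.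
by rewrite -{2}(ger0_norm xn0); exact/le_trans/ler_dist_dist.
Qed.

Lemma cvg_complex_le x l c : x @ \oo --> (l : R[i]^o) ->
  (\forall n \near \oo, x n <= c) -> l <= c.
Proof.
move=> xl xc; rewrite -subr_ge0.
apply: (@cvg_complex_ge0 (fun n => c - x n)).
  exact: (@cvgB _ R[i]^o _ _ _ (fun=> c) x _ _ (cvg_cst _) xl).
by apply: filterS xc => n; rewrite subr_ge0.
Qed.

End ComplexSequences.

(** * Riesz representation and adjoints *)

Section HilbertSpaces.
Variables (R : realType) (H : hilbertType R).
Implicit Types u v w : H.

Lemma innerC u v : inner v u = (inner u v)^*%R.
Proof. by rewrite /inner hermC expr0 mul1r. Qed.

Lemma inner_norm u : inner u u = `|u| ^+ 2.
Proof. exact: hdot_norm. Qed.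

Lemma inner_scalar u : scalar (inner u).
Proof. by move=> a v w; rewrite /inner linearDl linearZl_LR. Qed.

HB.instance Definition _ u :=
  GRing.isLinear.Build R[i] H R[i] *%R (inner u) (inner_scalar u).

Lemma innerDl u v w : inner (u + v) w = inner u w + inner v w.
Proof. by rewrite /inner linearDr. Qed.

Lemma innerBl u v w : inner (u - v) w = inner u w - inner v w.
Proof. by rewrite /inner linearBr. Qed.

Lemma innerZl a u v : inner (a *: u) v = a^*%R * inner u v.
Proof. by rewrite /inner linearZr_LR. Qed.

Lemma innerDr u v w : inner u (v + w) = inner u v + inner u w.
Proof. exact: linearD. Qed.

Lemma innerBr u v w : inner u (v - w) = inner u v - inner u w.
Proof. exact: linearB. Qed.

Lemma innerZr a u v : inner u (a *: v) = a * inner u v.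
Proof. exact: linearZ. Qed.

Lemma inner_suml n (F : 'I_n -> H) v :
  inner (\sum_i F i) v = \sum_i inner (F i) v.
Proof. by rewrite /inner linear_sumr. Qed.

Lemma inner_sumr n u (F : 'I_n -> H) :
  inner u (\sum_i F i) = \sum_i inner u (F i).
Proof. exact: linear_sum. Qed.

Lemma inner_CauchySchwarz u v : `|inner u v| <= `|u| * `|v|.
Proof.
rewrite -(ler_pXn2r (n := 2)) ?nnegrE ?mulr_ge0// exprMn -!inner_norm mulrC.
apply: psd_form_CauchySchwarz => w.
by rewrite -[leRHS]/(hdot w w) hdot_norm exprn_ge0.
Qed.

Lemma parallelogram u v :
  `|u - v| ^+ 2 = 2 * (`|u| ^+ 2 + `|v| ^+ 2) - `|u + v| ^+ 2.
Proof.
by rewrite -!inner_norm innerBl innerDl !(innerBr, innerDr); ring.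
Qed.

Lemma inner_ext u v : (forall w, inner u w = inner v w) -> u = v.
Proof.
move=> uv; apply/eqP; rewrite -subr_eq0 -normr_eq0 -sqrf_eq0 -inner_norm.
by rewrite innerBl uv subrr.
Qed.

Lemma inner_extr u v : (forall w, inner w u = inner w v) -> u = v.
Proof.
by move=> uv; apply: inner_ext => w; rewrite innerC uv -innerC.
Qed.

(* A minimising sequence of [J u = |u|^2 - 2 Re (f u)] is Cauchy by the
   parallelogram law, and its limit represents [f]. *)
Lemma Riesz_representation (f : H -> R[i]) (f_scalar : scalar f) (M : R[i]) :
  (forall u, `|f u| <= M * `|u|) -> exists z, forall v, f v = inner z v.
Proof.
move=> fM.
have fD u v : f (u + v) = f u + f v.
  by rewrite -{1}[u]scale1r f_scalar mul1r.
have f0 : f 0 = 0 by apply: (addrI (f 0)); rewrite -fD !addr0.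
have fZ a u : f (a *: u) = a * f u.
  by rewrite -[a *: u]addr0 f_scalar f0 addr0.
have fBZ a u v : f (u - a *: v) = f u - a * f v.
  by rewrite -scaleNr addrC f_scalar mulNr addrC.
pose j u := `|u| ^+ 2 - (f u + (f u)^*%R).
(* The values of [j] are real but typed in [R[i]]; [J] moves them to [R], where infima exist. *)
pose J u := complex.Re (j u).
have conjD_real (x : R[i]) : x + x^*%R \is Num.real.
  by rewrite CrealE rmorphD/= conjCK addrC.
have jJ u : j u = (J u)%:C.
  by rewrite /J RRe_real// rpredB ?rpredX ?normr_real.
(* From [2 Re (f u) <= 2 |M| |u|], completing the square leaves [(|u| - |M|)^2 - |M|^2] as a lower
   bound. *)
have j_ge u : - `|M| ^+ 2 <= j u.
  have fu : f u + (f u)^*%R <= 2 * (`|M| * `|u|).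
    rewrite (le_trans (addC_conj_le _))//.
    rewrite ler_pM2l// -[X in _ * X]normr_id -normrM.
    by rewrite ger0_norm// (le_trans _ (fM u)).
  rewrite /j -subr_ge0 opprK.
  rewrite [leRHS](_ : _ = (`|u| - `|M|) ^+ 2 +
    (2 * (`|M| * `|u|) - (f u + (f u)^*%R))); last by ring.
  by rewrite addr_ge0 ?subr_ge0// real_exprn_even_ge0// rpredB ?normr_real.
have hasinf : has_inf (range J).
  split; first by exists (J 0); exists 0.
  exists (complex.Re (- `|M| ^+ 2)) => _ [u _ <-].
  by have := j_ge u; rewrite jJ lecE /= => /andP[].
pose m := (inf (range J))%:C : R[i].
have j_ge_m u : m <= j u.
  by rewrite jJ lecR; apply: inf_lbound; [case: hasinf|exists u].
have /choice[u_ u_m] : forall n, exists u, j u < m + n.+1%:R^-1.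
  move=> n; have [|_ [u _ <-] um] := @inf_adherent _ _ (n.+1%:R^-1) _ hasinf.
    by rewrite invr_gt0.
  exists u; rewrite jJ.
  have -> : n.+1%:R^-1 = (n.+1%:R^-1 : R)%:C by rewrite fmorphV/= rmorph_nat.
  by rewrite -rmorphD ltcR.
(* The linear part of [j] cancels in the parallelogram identity, and [j] is at least [m] at the
   midpoint. *)
have u_cauchy k l : `|u_ k - u_ l| ^+ 2 <= 2 * (k.+1%:R^-1 + l.+1%:R^-1).
  have -> : `|u_ k - u_ l| ^+ 2 =
      2 * j (u_ k) + 2 * j (u_ l) - 4 * j (2^-1 *: (u_ k + u_ l)).
    rewrite parallelogram /j normrZ exprMn !fZ !fD.
    rewrite !rmorphM/= !rmorphD/= fmorphV/= rmorph_nat ger0_norm ?invr_ge0//.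
    by field.
  rewrite -[leRHS](addrK (4 * m)) lerB ?ler_pM2l//.
  rewrite (_ : _ + 4 * m = 2 * (m + k.+1%:R^-1) + 2 * (m + l.+1%:R^-1)).
    by rewrite lerD// ler_pM2l// ltW.
  by ring.
have /cauchy_cvg/cvg_ex[z u_z] : cauchy (u_ @ \oo).
  apply/cauchy_seqP => e e0.
  have e4 : 0 < e ^+ 2 / 4 by rewrite divr_gt0 ?exprn_gt0.
  have [N _ Ne] := near_infty_complex_natSinv_lt e4.
  exists N => k l Nk Nl; rewrite -(ler_pXn2r (n := 2)) ?nnegrE ?(ltW e0)//.
  rewrite (le_trans (u_cauchy _ _))//.
  rewrite [leRHS](_ : _ = 2 * (e ^+ 2 / 4 + e ^+ 2 / 4)); last by field.
  by rewrite ler_pM2l// lerD// ltW//; apply: Ne.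
(* Optimality up to [1/n] along the direction [v]. *)
have u_opt n v : `|inner (u_ n) v - f v| ^+ 2 <= (`|v| ^+ 2 + 1) / n.+1%:R.
  have [a aE] : exists a, inner (u_ n) v = a + f v.
    by exists (inner (u_ n) v - f v); rewrite subrK.
  have [q qE] : exists q, `|v| ^+ 2 = q - 1.
    by exists (`|v| ^+ 2 + 1); rewrite addrK.
  have q0 : 0 < q by rewrite -(subrK 1 q) -qE ltr_wpDl// exprn_ge0.
  rewrite aE qE addrK subrK.
  have qR : q^*%R = q by exact/CrealP/ger0_real/ltW.
  (* The exact minimiser along [v] would divide by [|v|^2]; dividing by [q = |v|^2 + 1] covers
     [v = 0] and still lowers [j] by at least [|a|^2 / q]. *)
  have := j_ge_m (u_ n - (a^*%R / q) *: v).
  have -> : j (u_ n - (a^*%R / q) *: v) =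
      j (u_ n) - `|a| ^+ 2 / q * (2 - `|v| ^+ 2 / q).
    have -> : j (u_ n - (a^*%R / q) *: v) = `|u_ n - (a^*%R / q) *: v| ^+ 2 -
       (f (u_ n) - (a^*%R / q) * f v + ((f (u_ n))^*%R - (a / q) * (f v)^*%R)).
      by rewrite /j fBZ rmorphB/= rmorphM/= rmorphM/= conjCK fmorphV/= qR.
    rewrite /j -!inner_norm innerBl !innerBr innerZl !innerZr innerZl.
    rewrite (innerC (u_ n) v) rmorphM/= conjCK fmorphV/= qR normCK.
    by rewrite aE rmorphD/=; field; exact: lt0r_neq0.
  rewrite (_ : 2 - _ = 1 + q^-1); last first.
    by rewrite qE; field; exact: lt0r_neq0.
  have aq0 : 0 <= `|a| ^+ 2 / q by rewrite divr_ge0 ?exprn_ge0// ltW.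
  rewrite lerBrDr => /le_lt_trans/(_ (u_m n)).
  rewrite ltrD2l mulrDr mulr1 => /ltW aqn.
  rewrite [leRHS]mulrC -ler_pdivrMr// (le_trans _ aqn)// lerDl.
  by rewrite divr_ge0 // ltW.
exists z => v; apply/eqP; rewrite -subr_eq0 -normr_le0.
apply/ler_addgt0Pr => e e0; rewrite add0r.
have v0 : 0 < `|v| ^+ 2 + 1 by rewrite ltr_wpDl// exprn_ge0.
have v1 : 0 < `|v| + 1 by rewrite ltr_wpDl.
have e1 : 0 < e / 2 / (`|v| + 1) by rewrite !divr_gt0.
have e2 : 0 < (e / 2) ^+ 2 / (`|v| ^+ 2 + 1).
  by rewrite divr_gt0 ?exprn_gt0 ?divr_gt0.
have [n [uzn ne2]] := filter_ex (filterI (cvgr_dist_le _ _ u_z _ e1)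
  (near_infty_complex_natSinv_lt e2)).
rewrite (splitr e) (le_trans (ler_distD (inner (u_ n) v) _ _))// lerD//.
  rewrite distrC -(ler_pXn2r (n := 2)) ?nnegrE ?divr_ge0 ?(ltW e0)//.
  rewrite (le_trans (u_opt _ _))// mulrC -ler_pdivlMr// ltW//.
rewrite distrC -innerBl (le_trans (inner_CauchySchwarz _ _))//.
rewrite (le_trans (ler_wpM2r _ uzn))// mulrAC ler_pdivrMr//.
by rewrite ler_wpM2l ?divr_ge0 ?lerDl// ltW.
Qed.

End HilbertSpaces.

Section Adjoint.
Variables (R : realType) (H1 H2 : hilbertType R).
Implicit Type S : bop H1 H2.

(** The default in [adjoint] is excluded by building an adjoint: Riesz represents [v |-> <w, S v>]
    for each [w], and the resulting map [t] is bounded since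
    [|t x|^2 = <x, S (t x)> <= M |x| |t x|]. *)
Lemma adjointP S u v : inner u (S v) = inner (adjoint S u) v.
Proof.
rewrite /adjoint; case: xgetP => [T _ ->//|noT]; exfalso.
have [M M0 SM] := bop_bounded S.
have /choice[t tP] : forall w, exists t, forall v, inner w (S v) = inner t v.
  move=> w; apply: (@Riesz_representation _ _ _ _ (`|w| * M)) => [a x y|x].
    by rewrite linearP innerDr innerZr.
  by rewrite (le_trans (inner_CauchySchwarz _ _))// -mulrA ler_wpM2l.
have t_bounded : t \in @is_bounded_op R H2 H1.
  apply/asboolP; split=> [a x y|].
    by apply: inner_ext => w; rewrite -tP !(innerDl, innerZl) !tP.
  exists M => x; have [->|tx0] := eqVneq (t x) 0.
    by rewrite normr0 mulr_ge0.
  have tx_gt0 : 0 < `|t x| by rewrite normr_gt0.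
  rewrite -(ler_pM2r tx_gt0) -expr2 -inner_norm -tP.
  rewrite -[leLHS]ger0_norm; last by rewrite tP inner_norm exprn_ge0.
  rewrite (le_trans (inner_CauchySchwarz _ _))// (mulrC M) -mulrA.
  by rewrite ler_wpM2l.
exact: (noT (Bop t_bounded)).
Qed.

Lemma adjoint_unique S (T : bop H2 H1) :
  (forall u v, inner u (S v) = inner (T u) v) -> adjoint S = T.
Proof.
move=> ST; apply/val_inj/funext => u.
by apply: inner_ext => v; rewrite -adjointP ST.
Qed.

Lemma adjointPr S u v : inner (S u) v = inner u (adjoint S v).
Proof. by rewrite innerC adjointP -innerC. Qed.

End Adjoint.

Section BopApply.
Variables (R : realType) (H1 H2 : hilbertType R).
Implicit Types S T : bop H1 H2.

Lemma bopDE S T u : (S + T) u = S u + T u. Proof. by []. Qed.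
Lemma bopBE S T u : (S - T) u = S u - T u. Proof. by []. Qed.
Lemma bopZE a S u : (a *: S) u = a *: S u. Proof. by []. Qed.

End BopApply.

Lemma bopME (R : realType) (H : hilbertType R) (S T : 'B(H)) u :
  (S * T) u = S (T u).
Proof. by []. Qed.

Lemma adjoint1 (R : realType) (H : hilbertType R) : adjoint (1 : 'B(H)) = 1.
Proof. exact: adjoint_unique. Qed.

Lemma adjointM (R : realType) (H : hilbertType R) (S T : 'B(H)) :
  adjoint (S * T) = adjoint T * adjoint S.
Proof.
by apply: adjoint_unique => u v; rewrite -[(S * T) v]/(S (T v)) !adjointP.
Qed.

Lemma adjointK (R : realType) (H : hilbertType R) :
  involutive (@adjoint R H H).
Proof. by move=> S; apply: adjoint_unique => u v; rewrite adjointPr. Qed.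

(** * Extension of operators from a dense span *)

Section LinearSpan.
Variables (R : realType) (V : lmodType R[i]).
Implicit Types (A : set V) (u v : V).

Lemma lin_span_gen A u : A u -> lin_span A u.
Proof.
by move=> Au; exists 1, (fun=> 1), (fun=> u); rewrite big_ord1 scale1r.
Qed.

Lemma lin_spanP A a u v :
  lin_span A u -> lin_span A v -> lin_span A (a *: u + v).
Proof.
move=> [m [c [x [xA ->]]]] [n [d [y [yA ->]]]].
exists (m + n)%N.
exists (fun i =>
  match fintype.split i with inl i => a * c i | inr j => d j end).
exists (fun i => match fintype.split i with inl i => x i | inr j => y j end).
split=> [i|]; first by case: fintype.split.
rewrite big_split_ord scaler_sumr/=; congr (_ + _); apply: eq_bigr => i _.
  by rewrite (unsplitK (inl i)) scalerA.
by rewrite (unsplitK (inr i)).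
Qed.

Lemma lin_span0 A : lin_span A 0.
Proof. by exists 0, (fun=> 0), (fun=> 0); split=> [[]|]; rewrite ?big_ord0. Qed.

Lemma lin_spanB A u v : lin_span A u -> lin_span A v -> lin_span A (u - v).
Proof. by rewrite addrC -scaleN1r => uA vA; exact: lin_spanP. Qed.

End LinearSpan.

Section DenseSpan.
Variables (R : realType) (H1 H2 : hilbertType R).

Lemma bop_eq_dense (A : set H1) (S T : bop H1 H2) :
  closure (lin_span A) = setT -> (forall u, A u -> S u = T u) -> S = T.
Proof.
move=> A_dense ST; apply/val_inj/funext => /= u.
have ST_span v : lin_span A v -> S v = T v.
  move=> [n [c [a [aA ->]]]]; rewrite !linear_sum; apply: eq_bigr => i _.
  by rewrite !linearZ/= ST.
have [M M0 DM] := bop_bounded (S - T).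
apply/eqP; rewrite -subr_eq0 -normr_le0; apply/ler_addgt0Pr => e e0.
have M1 : 0 < M + 1 by rewrite ltr_wpDl.
have : closure (lin_span A) u by rewrite A_dense.
move=> /closure_normP/(_ (e / (M + 1)))[|v vA uv]; first by rewrite divr_gt0.
have -> : S u - T u = (S - T) (u - v).
  rewrite -[RHS]/(S (u - v) - T (u - v)) (linearB S) (linearB T)/=.
  by rewrite (ST_span v)// opprB addrA subrK.
rewrite add0r (le_trans (DM _))// (le_trans (ler_wpM2l M0 (ltW uv)))//.
by rewrite mulrCA ger_pMr// ler_pdivrMr// mul1r lerDl.
Qed.

(** The operator is obtained through its graph: [G] is the span of the pairs [(k x, l x)] and [G']
    its closure. Dependent vectors [k x] cause no trouble, because the bound, inherited by [G'],
    makes it single-valued. *)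
Lemma bop_dense_extension (X : Type) (k : X -> H1) (l : X -> H2) (M : R[i]) :
  closure (lin_span (range k)) = setT -> 0 <= M ->
  (forall n (c : 'I_n -> R[i]) (x : 'I_n -> X),
    `|\sum_i c i *: l (x i)| <= M * `|\sum_i c i *: k (x i)|) ->
  exists T : bop H1 H2, forall x, T (k x) = l x.
Proof.
move=> k_dense M0 klM.
pose G : set (H1 * H2) := lin_span (range (fun x => (k x, l x))).
pose G' (p : H1 * H2) := forall e : R[i], 0 < e ->
  exists2 q, G q & `|p.1 - q.1| < e /\ `|p.2 - q.2| < e.
have GM p : G p -> `|p.2| <= M * `|p.1|.
  move=> [n [c [a [a_kl ->]]]].
  have /choice[x xP] : forall i, exists x, (k x, l x) = a i.
    by move=> i; have [x _ <-] := a_kl i; exists x.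
  rewrite (_ : (\sum_i c i *: a i).1 = \sum_i c i *: k (x i)); last first.
    by rewrite (linear_sum fst); apply: eq_bigr => i _; rewrite -xP.
  rewrite (_ : (\sum_i c i *: a i).2 = \sum_i c i *: l (x i))//.
  by rewrite (linear_sum snd); apply: eq_bigr => i _; rewrite -xP.
have G'M p : G' p -> `|p.2| <= M * `|p.1|.
  move=> pG; apply/ler_addgt0Pr => e e0.
  have M1 : 0 < M + 1 by rewrite ltr_wpDl.
  have [|q qG [pq1 pq2]] := pG (e / (M + 1)); first by rewrite divr_gt0.
  have q1 : `|q.1| <= `|p.1| + e / (M + 1).
    rewrite -[q.1](subrK p.1) addrC (le_trans (ler_normD _ _))// lerD2l distrC.
    exact: ltW.
  have q2 : `|p.2| <= `|q.2| + e / (M + 1).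
    rewrite -[p.2](subrK q.2) addrC (le_trans (ler_normD _ _))// lerD2l.
    exact: ltW.
  rewrite (le_trans q2)// (le_trans (lerD (GM _ qG) (lexx _)))//.
  rewrite (le_trans (lerD (ler_wpM2l M0 q1) (lexx _)))// mulrDr -addrA lerD2l.
  by rewrite (_ : _ + _ = e)//; field; exact: lt0r_neq0.
have G'P a p q : G' p -> G' q -> G' (a *: p + q).
  move=> pG qG e e0; have a1 : 0 < `|a| + 1 by rewrite ltr_wpDl.
  have ea0 : 0 < e / (`|a| + 1) by rewrite divr_gt0.
  have [p' pG' [p1 p2]] := pG _ ea0; have [q' qG' [q1 q2]] := qG _ ea0.
  exists (a *: p' + q'); first exact: lin_spanP.
  have eE : e = `|a| * (e / (`|a| + 1)) + e / (`|a| + 1).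
    by field; exact: lt0r_neq0.
  split; rewrite /= opprD addrACA -scalerBr.
    rewrite (le_lt_trans (ler_normD _ _))// normrZ eE ler_ltD//.
    by rewrite ler_wpM2l// ltW.
  rewrite (le_lt_trans (ler_normD _ _))// normrZ eE ler_ltD//.
  by rewrite ler_wpM2l// ltW.
(* Approximants of [u] in the span have Cauchy second components by [GM], and [H2] is complete. *)
have /choice[t tP] : forall u, exists w, G' (u, w).
  move=> u.
  have /choice[q qP] : forall n, exists q, G q /\ `|u - q.1| < n.+1%:R^-1.
    move=> n; have : closure (lin_span (range k)) u by rewrite k_dense.
    move=> /closure_normP/(_ n.+1%:R^-1)[|v [m [c [a [ka ->]]]] uv].
      by rewrite invr_gt0.
    have /choice[x xP] : forall i, exists x, k x = a i.
      by move=> i; have [x _ <-] := ka i; exists x.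
    exists (\sum_i c i *: (k (x i), l (x i))); split.
      exists m, c, (fun i => (k (x i), l (x i))).
      by split=> // i; exists (x i).
    rewrite (linear_sum fst)/= (le_lt_trans _ uv)//.
    by under eq_bigr do rewrite xP.
  have /cauchy_cvg/cvg_ex[w q_w] : cauchy ((fun n => (q n).2) @ \oo).
    apply/cauchy_seqP => e e0.
    have e1 : 0 < e / (2 * (M + 1)) by rewrite divr_gt0 ?mulr_gt0 ?ltr_wpDl.
    have [N _ Ne] := near_infty_complex_natSinv_lt e1.
    exists N => m n Nm Nn.
    have := GM _ (lin_spanB (qP m).1 (qP n).1).
    move=> /le_trans; apply.
    have /(ler_wpM2l M0)/le_trans : `|(q m - q n).1| <=
        e / (2 * (M + 1)) + e / (2 * (M + 1)).
      rewrite /= (le_trans (ler_distD u _ _))// lerD//.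
        by rewrite distrC ltW// (lt_trans (qP m).2)//; exact: Ne.
      by rewrite ltW// (lt_trans (qP n).2)//; exact: Ne.
    apply.
    rewrite (_ : M * _ = M / (M + 1) * e); last first.
      by field; rewrite lt0r_neq0// ltr_wpDl.
    by rewrite ger_pMl// ler_pdivrMr ?mul1r ?lerDl// ltr_wpDl.
  exists w => e e0.
  have [n [wqn ne]] := filter_ex (filterI (cvgr_dist_lt _ _ q_w _ e0)
    (near_infty_complex_natSinv_lt e0)).
  by exists (q n); [exact: (qP n).1|split=> //=; exact: lt_trans (qP n).2 ne].
have t_bounded : t \in @is_bounded_op R H1 H2.
  apply/asboolP; split=> [a u v|]; last by exists M => u; exact: G'M (tP u).
  (* Two points of [G'] over the same vector differ by some [(0, w)], and [G'M] forces [w = 0]. The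
     value at [k x] is identified in the same way. *)
  have := G'P (-1) _ _ (tP (a *: u + v)) (G'P a _ _ (tP u) (tP v)).
  move=> /G'M/=; rewrite !scaleN1r addNr normr0 mulr0 normr_le0.
  by rewrite addr_eq0 eqr_opp => /eqP.
exists (Bop t_bounded) => x /=.
have kl : G' (k x, l x).
  move=> e e0; exists (k x, l x); first by apply: lin_span_gen; exists x.
  by split; rewrite subrr normr0.
have := G'P (-1) _ _ (tP (k x)) kl.
move=> /G'M/=; rewrite !scaleN1r addNr normr0 mulr0 normr_le0.
by rewrite addr_eq0 eqr_opp => /eqP.
Qed.
End DenseSpan.

(** * Completion of a pre-Hilbert space *)

Section DotCauchy.
Variables (R : realType) (V : lmodType R[i]) (d : {dot V for Num.conj}).
Implicit Types u v w : nat -> V.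

Definition dcauchy u := forall e : R[i], 0 < e ->
  exists N, forall m n, (N <= m)%N -> (N <= n)%N -> dlen d (u m - u n) <= e.

(* MathComp forms are linear on the left: [d x y] stands for [<y, x>], so that
   [u] represents the functional [x |-> lim <x, u n>]. *)
Definition represents u (f : V -> R[i]^o) :=
  forall x : V, d (u n) x @[n --> \oo] --> f x.

Lemma dcauchyP a u v : dcauchy u -> dcauchy v ->
  dcauchy (fun n => a *: u n + v n).
Proof.
move=> uc vc e e0; have a1 : 0 < `|a| + 1 by rewrite ltr_wpDl.
have ea0 : 0 < e / (`|a| + 1) by rewrite divr_gt0.
have [N uN] := uc _ ea0; have [M vM] := vc _ ea0.
exists (maxn N M) => m n; rewrite !geq_max => /andP[Nm Mm] /andP[Nn Mn].
rewrite opprD addrACA -scalerBr (le_trans (dlenD _ _ _))// dlenZ.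
rewrite (_ : e = `|a| * (e / (`|a| + 1)) + e / (`|a| + 1)); last first.
  by field; exact: lt0r_neq0.
by rewrite lerD ?vM// ler_wpM2l ?uN.
Qed.

Lemma dcauchy_cst x : dcauchy (fun=> x).
Proof. by move=> e e0; exists 0 => m n _ _; rewrite subrr dlen0 ltW. Qed.

Lemma dcauchyB u v : dcauchy u -> dcauchy v -> dcauchy (fun n => u n - v n).
Proof.
move=> uc vc; have := dcauchyP (-1) vc uc; congr dcauchy.
by apply/funext => n; rewrite scaleN1r addrC.
Qed.

Lemma representsP a u v f g : represents u f -> represents v g ->
  represents (fun n => a *: u n + v n) (a *: f + g).
Proof.
move=> uf vg x; rewrite (_ : (a *: f + g) x = a *: f x + g x)//.
under eq_fun do rewrite linearDl linearZl_LR/=.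
by apply: (@cvgD _ R[i]^o); [exact: (@cvgZr _ R[i]^o)|].
Qed.

Lemma representsB u v f g : represents u f -> represents v g ->
  represents (fun n => u n - v n) (f - g).
Proof.
move=> uf vg x; have := @representsP (-1) _ _ _ _ vg uf x.
by under eq_fun do rewrite scaleN1r addrC; rewrite scaleN1r addrC.
Qed.

Lemma dcauchy_bounded u : dcauchy u ->
  exists2 B, 0 < B & \forall n \near \oo, dlen d (u n) <= B.
Proof.
move=> uc; have [N uN] := uc 1 ltr01.
exists (dlen d (u N) + 1); first by rewrite ltr_wpDl// dlen_ge0.
exists N => // n /= Nn; rewrite -[u n](subrK (u N)) addrC.
by rewrite (le_trans (dlenD _ _ _))// lerD2l uN.
Qed.

Lemma dcauchy_dot_cvg u v : dcauchy u -> dcauchy v ->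
  exists l : R[i]^o, d (u n) (v n) @[n --> \oo] --> l.
Proof.
move=> uc vc; apply: complex_cauchy_cvg => e e0.
have [B B0 [N1 _ uB]] := dcauchy_bounded uc.
have [B' B'0 [N2 _ vB]] := dcauchy_bounded vc.
have [|N3 uN] := uc (e / (2 * B')); first by rewrite divr_gt0 ?mulr_gt0.
have [|N4 vN] := vc (e / (2 * B)); first by rewrite divr_gt0 ?mulr_gt0.
exists (maxn (maxn N1 N2) (maxn N3 N4)) => m n.
rewrite !geq_max => /andP[/andP[_ m2] /andP[m3 m4]].
move=> /andP[/andP[n1 _] /andP[n3 n4]].
rewrite (_ : _ - _ = d (u m - u n) (v m) + d (u n) (v m - v n)); last first.
  by rewrite linearBl linearBr/= addrA subrK.
rewrite (splitr e) (le_trans (ler_normD _ _))// lerD//.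
  rewrite (le_trans (dlen_CauchySchwarz _ _ _))//.
  rewrite (le_trans (ler_pM _ _ (uN _ _ m3 n3) (vB _ m2))) ?dlen_ge0//.
  by rewrite le_eqVlt; apply/orP/or_introl/eqP; field; exact: lt0r_neq0.
rewrite (le_trans (dlen_CauchySchwarz _ _ _))//.
rewrite (le_trans (ler_pM _ _ (uB _ n1) (vN _ _ m4 n4))) ?dlen_ge0//.
by rewrite le_eqVlt; apply/orP/or_introl/eqP; field; exact: lt0r_neq0.
Qed.

(** The hypothesis gives convergence against fixed vectors only. Freezing [v] at a late index [N]
    costs at most [B |v n - v N|], as [w] is eventually bounded. *)
Lemma represents0_dot_cvg w v : dcauchy w -> dcauchy v -> represents w 0 ->
  d (w n) (v n) @[n --> \oo] --> (0 : R[i]^o).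
Proof.
move=> wc vc w0; apply/cvg_complexP => e e0.
have [B B0 wB] := dcauchy_bounded wc.
have [|N vN] := vc (e / (2 * B)); first by rewrite divr_gt0 ?mulr_gt0.
have /cvg_complexP/(_ (e / 2))/= := w0 (v N).
rewrite divr_gt0// => /(_ isT) wN.
near=> n; rewrite sub0r normrN (_ : d (w n) (v n) =
  d (w n) (v N) + d (w n) (v n - v N)); last by rewrite linearBr/= addrC subrK.
rewrite (splitr e) (le_trans (ler_normD _ _))// lerD//.
  by rewrite -normrN -sub0r; near: n.
rewrite (le_trans (dlen_CauchySchwarz _ _ _))//.
rewrite (le_trans (ler_pM _ _ (_ : _ <= B) (vN n N _ _))) ?dlen_ge0//.
- by near: n.
- by near: n; exists N.
by rewrite le_eqVlt; apply/orP/or_introl/eqP; field; exact: lt0r_neq0.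
Unshelve. all: by end_near. Qed.

(** The limit of the products depends only on the functionals represented, which is what makes
    [cdot] well defined. Replacing [u] by [u'] and then [v] by [v'] changes the products by null
    sequences. *)
Lemma represents_dot_cvg u u' v v' f g (l : R[i]^o) :
  dcauchy u -> dcauchy u' -> dcauchy v -> dcauchy v' ->
  represents u f -> represents u' f -> represents v g -> represents v' g ->
  d (u n) (v n) @[n --> \oo] --> l -> d (u' n) (v' n) @[n --> \oo] --> l.
Proof.
move=> uc u'c vc v'c uf u'f vg v'g uvl.
have rep0 x y h : represents x h -> represents y h ->
    represents (fun n => x n - y n) 0.
    by move=> xh yh; rewrite -(subrr h); exact: representsB.
have uu' := represents0_dot_cvg (dcauchyB uc u'c) vc (rep0 _ _ _ uf u'f).
have vv' := cvg_conj
  (represents0_dot_cvg (dcauchyB vc v'c) u'c (rep0 _ _ _ vg v'g)).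
have := @cvgB _ R[i]^o _ _ _ _ _ _ _ (@cvgB _ R[i]^o _ _ _ _ _ _ _ uvl uu') vv'.
rewrite rmorph0 !subr0 => lim.
apply: (eq_cvg_complex _ (lim _ _)) => n /=.
rewrite -[LHS]/(d (u n) (v n) - d (u n - u' n) (v n) -
  (d (v n - v' n) (u' n))^*%R) -herm_conj.
by rewrite !linearBl !linearBr/=; ring.
Qed.

End DotCauchy.

Section Completion.
Variables (R : realType) (V : lmodType R[i]) (d : {dot V for Num.conj}).

(* A point of the completion is encoded as the functional represented by a
   Cauchy sequence, so that no quotient of sequences is needed. *)
Definition is_dot_limit : {pred (V -> R[i]^o)} := fun f =>
  `[< exists2 u, dcauchy d u & represents d u f >].

Record completion := Completion {
  completion_fun :> V -> R[i]^o;
  _ : completion_fun \in is_dot_limit }.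

HB.instance Definition _ := [isSub for completion_fun].
HB.instance Definition _ := [Choice of completion by <:].

Lemma is_dot_limit_submod : submod_closed is_dot_limit.
Proof.
split.
  apply/asboolP; exists (fun=> 0); first exact: dcauchy_cst.
  move=> x; under eq_fun do rewrite linear0l.
  exact: (@cvg_cst R[i]^o).
move=> a f g /asboolP[u uc uf] /asboolP[v vc vg]; apply/asboolP.
by exists (fun n => a *: u n + v n); [exact: dcauchyP|exact: representsP uf vg].
Qed.

HB.instance Definition _ := GRing.isSubmodClosed.Build R[i] (V -> R[i]^o)
  is_dot_limit is_dot_limit_submod.
HB.instance Definition _ := [SubChoice_isSubLmodule of completion by <:].

Implicit Types f g h : completion.

Lemma completionP f : exists2 u, dcauchy d u & represents d u f.
Proof. by case: f => f /= /asboolP. Qed.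

(** The set is a singleton: limits exist by [dcauchy_dot_cvg] and do not depend on the sequences by
    [represents_dot_cvg], so the default is never returned. *)
Definition cdot f g : R[i] :=
  xget 0 [set l | exists u v, [/\ dcauchy d u, dcauchy d v, represents d u f,
    represents d v g & d (u n) (v n) @[n --> \oo] --> (l : R[i]^o)]].

Lemma cdotP u v f g : dcauchy d u -> dcauchy d v ->
  represents d u f -> represents d v g ->
  d (u n) (v n) @[n --> \oo] --> (cdot f g : R[i]^o).
Proof.
move=> uc vc uf vg; rewrite /cdot; case: xgetP => [l _ [u' [v' []]]|noL].
  by move=> u'c v'c u'f v'g; apply: represents_dot_cvg u'f uf v'g vg.
have [l lP] := dcauchy_dot_cvg uc vc; exfalso.
by apply: (noL l); exists u, v.
Qed.

Lemma cdotPl a f g h : cdot (a *: f + g) h = a * cdot f h + cdot g h.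
Proof.
have [u uc uf] := completionP f; have [v vc vg] := completionP g.
have [w wc wh] := completionP h.
have fg : represents d _ (a *: f + g) := representsP uf vg.
have := cdotP (dcauchyP a uc vc) wc fg wh.
move/cvg_complex_unique; apply.
under eq_fun do rewrite linearDl linearZl_LR/=.
apply: (@cvgD _ R[i]^o); last exact: cdotP.
by apply: (@cvgZr _ R[i]^o); exact: cdotP.
Qed.

Lemma cdotC f g : cdot f g = (cdot g f)^*%R.
Proof.
have [u uc uf] := completionP f; have [v vc vg] := completionP g.
apply: (cvg_complex_unique (cdotP uc vc uf vg)).
under eq_fun do rewrite herm_conj.
exact/cvg_conj/cdotP.
Qed.

Lemma cdot_bilinear : bilinear_for *%R (Num.conj \; *%R) cdot.
Proof.
split=> [h a f g|h a f g] /=; first exact: cdotPl.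
by rewrite (cdotC h) cdotPl rmorphD rmorphM/= (cdotC h f) (cdotC h g).
Qed.

Lemma cdot_hermitian f g : cdot f g = (-1) ^+ false * (cdot g f)^*%R.
Proof. by rewrite expr0 mul1r cdotC. Qed.

(** If [cdot f f = 0], the lengths of a representing sequence tend to [0], and Cauchy-Schwarz makes
    each value of [f] zero. *)
Lemma cdot_gt0 f : f != 0 -> 0 < cdot f f.
Proof.
move=> f0; have [u uc uf] := completionP f.
have lim := cdotP uc uc uf uf.
have ge0 : 0 <= cdot f f.
  by apply: (cvg_complex_ge0 lim); near=> n; exact: dot_ge0.
rewrite lt_def ge0 andbT; apply: contra_neq f0 => cdot0.
apply/val_inj/funext => x /=; apply: (cvg_complex_unique (uf x)).
apply/cvg_complexP => e e0; rewrite cdot0 in lim.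
have x1 : 0 < dlen d x + 1 by rewrite ltr_wpDl// dlen_ge0.
have e1 : 0 < (e / (dlen d x + 1)) ^+ 2 by rewrite exprn_gt0// divr_gt0.
move/cvg_complexP : lim => /(_ _ e1); apply: filterS => n.
rewrite !sub0r !normrN -dlen_sqr ger0_norm ?exprn_ge0 ?dlen_ge0//.
rewrite ler_pXn2r ?nnegrE ?dlen_ge0 ?divr_ge0 ?(ltW e0) ?(ltW x1)// => un.
rewrite (le_trans (dlen_CauchySchwarz _ _ _))//.
rewrite (le_trans (ler_wpM2r (dlen_ge0 _ _) un))// mulrAC ler_pdivrMr//.
by rewrite ler_wpM2l ?lerDl// ltW.
Unshelve. all: by end_near. Qed.

HB.instance Definition _ := bilinear_isBilinear.Build R[i] completion completion
  R[i] *%R (Num.conj \; *%R) cdot cdot_bilinear.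
HB.instance Definition _ := isHermitianSesquilinear.Build R[i] completion
  false Num.conj cdot cdot_hermitian.
HB.instance Definition _ := isDotProduct.Build R[i] completion cdot cdot_gt0.

Definition completion_dot : {dot completion for Num.conj} := cdot.

HB.instance Definition _ := Lmodule_isNormed.Build R[i] completion
  (dlenD completion_dot) (dlenZ completion_dot) (@dlen_eq0 _ _ completion_dot).

Lemma completion_norm_sqr f : cdot f f = `|f| ^+ 2.
Proof. by rewrite -[RHS]/(dlen completion_dot f ^+ 2) dlen_sqr. Qed.

Lemma cpl_embed_subproof (v : V) : (d v : V -> R[i]^o) \in is_dot_limit.
Proof.
apply/asboolP; exists (fun=> v); first exact: dcauchy_cst.
by move=> x; exact: (@cvg_cst R[i]^o).
Qed.

Definition cpl_embed (v : V) : completion := Completion (cpl_embed_subproof v).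

Lemma represents_cpl_embed v : represents d (fun=> v) (cpl_embed v).
Proof. by move=> x; exact: (@cvg_cst R[i]^o). Qed.

Lemma cpl_embed_linear : linear cpl_embed.
Proof.
move=> a u v; apply/val_inj/funext => x /=.
by rewrite linearDl linearZl_LR.
Qed.

HB.instance Definition _ :=
  GRing.isLinear.Build R[i] V completion *:%R cpl_embed cpl_embed_linear.

(** Evaluating a functional is pairing it with an embedded vector; the reproducing property of the
    final space is this identity taken at sections. *)
Lemma cdot_cpl_embed f v : cdot f (cpl_embed v) = f v.
Proof.
have [u uc uf] := completionP f.
have := cdotP uc (dcauchy_cst d v) uf (@represents_cpl_embed v).
by move/cvg_complex_unique; apply; exact: uf.
Qed.

Lemma norm_cpl_embed v : `|cpl_embed v| = dlen d v.
Proof.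
apply/eqP; rewrite -(eqrXn2 (n := 2)) ?dlen_ge0//.
by rewrite -completion_norm_sqr cdot_cpl_embed dlen_sqr.
Qed.

(** The squared distance is the limit over [m] of [|u m - u n|^2], which the Cauchy property
    controls. *)
Lemma cpl_embed_approx f u : dcauchy d u -> represents d u f ->
  forall e : R[i], 0 < e -> \forall n \near \oo, `|f - cpl_embed (u n)| <= e.
Proof.
move=> uc uf e e0; have [N uN] := uc e e0; exists N => // n /= Nn.
rewrite -(ler_pXn2r (n := 2)) ?nnegrE ?(ltW e0)// -completion_norm_sqr.
have wc : dcauchy d (fun m => u m - u n) by exact: dcauchyB (dcauchy_cst _ _).
have wf : represents d (fun m => u m - u n) (f - cpl_embed (u n)).
  exact: representsB uf (@represents_cpl_embed (u n)).
apply: (cvg_complex_le (cdotP wc wc wf wf)); exists N => // m /= Nm.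
by rewrite -dlen_sqr ler_pXn2r ?nnegrE ?dlen_ge0 ?(ltW e0)// uN.
Qed.

(** Balls of radius [1/(n+1)] belonging to [F] have centres [g n], each approximated by an embedded
    [u n]. The sequence [u] is Cauchy, and the functional it represents is the limit of [F]. *)
Lemma completion_complete (F : set_system completion) :
  ProperFilter F -> cauchy F -> cvg F.
Proof.
move=> FF /cauchyP Fc.
have inv_gt0 n : 0 < n.+1%:R^-1 :> R[i] by rewrite invr_gt0.
have /choice[g gF] : forall n, exists g, F (ball g (n.+1%:R^-1 : R[i])).
  by move=> n; exact: Fc.
have /choice[u ug] : forall n, exists v, `|g n - cpl_embed v| <= n.+1%:R^-1.
  move=> n; have [v vc vg] := completionP (g n).
  have [m um] := filter_ex (cpl_embed_approx vc vg (inv_gt0 n)).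
  by exists (v m).
have uc : dcauchy d u.
  move=> e e0; have e4 : 0 < e / 4 by rewrite divr_gt0.
  have [N _ Ne] := near_infty_complex_natSinv_lt e4.
  exists N => m n Nm Nn; rewrite -norm_cpl_embed linearB/=.
  (* Two members of the proper filter [F] meet; the common point [h] links the centres [g m] and
     [g n]. *)
  have [h []] := filter_ex (filterI (gF m) (gF n)).
  rewrite -!ball_normE/= => hm hn.
  rewrite (le_trans (ler_distD (g m) _ _))//.
  rewrite (_ : e = e / 4 + (e / 4 + e / 4 + e / 4)); last by field.
  rewrite lerD//; first by rewrite distrC (le_trans (ug m))// ltW// Ne.
  rewrite (le_trans (ler_distD (g n) _ _))// lerD//; last first.
    by rewrite (le_trans (ug n))// ltW// Ne.
  rewrite (le_trans (ler_distD h _ _))// lerD//.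
    by rewrite ltW// (lt_trans hm)// Ne.
  by rewrite distrC ltW// (lt_trans hn)// Ne.
have /choice[f uf] : forall x, exists l : R[i]^o, d (u n) x @[n --> \oo] --> l.
  by move=> x; exact: dcauchy_dot_cvg uc (dcauchy_cst d x).
have fP : f \in is_dot_limit by apply/asboolP; exists u.
apply/cvg_ex; exists (Completion fP); apply/cvgrPdist_le => e e0.
have e3 : 0 < e / 3 by rewrite divr_gt0.
have [n [fun_ ne]] := filter_ex (filterI
  (@cpl_embed_approx (Completion fP) u uc uf _ e3)
  (near_infty_complex_natSinv_lt e3)).
apply: filterS (gF n) => h; rewrite -ball_normE/= => hn.
rewrite (le_trans (ler_distD (cpl_embed (u n)) _ _))//.
rewrite (_ : e = e / 3 + (e / 3 + e / 3)); last by field.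
apply: lerD; first exact: fun_.
rewrite (le_trans (ler_distD (g n) _ _))//; apply: lerD.
  by rewrite distrC (le_trans (ug n))// ltW.
exact/ltW/(lt_trans hn ne).
Qed.

HB.instance Definition _ :=
  Uniform_isComplete.Build completion completion_complete.
HB.instance Definition _ := CompleteNormedModule_isHilbert.Build R completion
  (completion_norm_sqr : forall f, completion_dot f f = `|f| ^+ 2).

Lemma inner_cpl_embed v f : inner (cpl_embed v) f = f v.
Proof. exact: cdot_cpl_embed. Qed.

Lemma closure_cpl_embed : closure (range cpl_embed) = setT.
Proof.
apply/seteqP; split=> // f _; apply/closure_normP => e e0.
have [u uc uf] := completionP f.
have e2 : 0 < e / 2 by rewrite divr_gt0.
have [n un] := filter_ex (cpl_embed_approx uc uf e2).
exists (cpl_embed (u n)); first by exists (u n).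
by rewrite (le_lt_trans un)// ltr_pdivrMr// ltr_pMr// ltr1n.
Qed.

End Completion.

(** * Existence of the reproducing kernel Hilbert space *)

(** Kernel and proof are bundled so that the type [kspan K] carries the positivity on which its
    inner product instances depend. *)
Record pd_kernel (R : realType) (X : Type) := PDKernel {
  pd_kernel_fun :> X -> X -> R[i];
  pd_kernelP : positive_definite_kernel pd_kernel_fun }.

Section KernelSpan.
Variables (R : realType) (X : Type) (K : pd_kernel R X).

(** Hermitian symmetry is not assumed: it follows from the quadratic form being real at coefficients
    [(1, 1)] and [(1, i)], which makes [K x y + K y x] and [i (K x y - K y x)] real. *)
Lemma pd_kernel_conj x y : K y x = (K x y)^*%R.
Proof.
have real_pd a b : a^*%R * a * K x x + a^*%R * b * K x y +
    (b^*%R * a * K y x + b^*%R * b * K y y) \is Num.real.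
  have := pd_kernelP K (fun i : 'I_2 => if i == ord0 then x else y)
    (fun i => if i == ord0 then a else b).
  by rewrite !big_ord_recl !big_ord0 /= !addr0 => /ger0_real.
have Kxx z : K z z \is Num.real.
  have := pd_kernelP K (fun i : 'I_1 => z) (fun=> 1).
  by rewrite !big_ord_recl !big_ord0 !addr0 conjC1 !mul1r => /ger0_real.
pose q a b := a^*%R * a * K x x + a^*%R * b * K x y +
  (b^*%R * a * K y x + b^*%R * b * K y y).
have sum_real : K x y + K y x \is Num.real.
  rewrite (_ : _ + _ = q 1 1 - K x x - K y y) ?rpredB//; first exact: real_pd.
  by rewrite /q conjC1; ring.
have diff_real : 'i%R * (K x y - K y x) \is Num.real.
  rewrite (_ : _ * _ = q 1 'i%R - K x x - K y y) ?rpredB//.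
    exact: real_pd.
  have -> : q 1 'i%R = K x x + 'i%R * K x y - 'i%R * K y x - 'i%R ^+ 2 * K y y.
    by rewrite /q conjC1 conjCi; ring.
  by rewrite sqrCi; ring.
have i_neq0 : ('i%R : R[i]) != 0 by exact: neq0Ci.
move: (CrealP sum_real) (CrealP diff_real).
rewrite rmorphD rmorphM rmorphB/= conjCi => e1 e2.
have {}e2 : (K y x)^*%R - (K x y)^*%R = K x y - K y x.
  by apply: (mulfI i_neq0); rewrite -e2; ring.
have : 2 * K y x = 2 * (K x y)^*%R.
  rewrite [LHS](_ : _ = (K x y + K y x) - (K x y - K y x)); last by ring.
  by rewrite -e1 -e2; ring.
by move/mulfI; apply; rewrite pnatr_eq0.
Qed.

Definition ksec x : X -> R[i]^o := K ^~ x.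

(** The span is taken among functions, so linear relations between sections already hold as
    equalities and no quotient by null vectors is needed. *)
Definition is_kspan : {pred (X -> R[i]^o)} := fun f =>
  `[< lin_span (range ksec) f >].

Record kspan := KSpan { kspan_fun :> X -> R[i]^o; _ : kspan_fun \in is_kspan }.

HB.instance Definition _ := [isSub for kspan_fun].
HB.instance Definition _ := [Choice of kspan by <:].

Lemma is_kspan_submod : submod_closed is_kspan.
Proof.
split; first by apply/asboolP; exact: lin_span0.
by move=> a f g /asboolP fK /asboolP gK; apply/asboolP; exact: lin_spanP.
Qed.

HB.instance Definition _ := GRing.isSubmodClosed.Build R[i] (X -> R[i]^o)
  is_kspan is_kspan_submod.
HB.instance Definition _ := [SubChoice_isSubLmodule of kspan by <:].

Implicit Types f g h : kspan.

Definition kspan_rep g n (c : 'I_n -> R[i]) (x : 'I_n -> X) :=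
  forall y, g y = \sum_i c i * K y (x i).

Lemma kspan_repP g : exists n (c : 'I_n -> R[i]) x, kspan_rep g c x.
Proof.
case: g => g gK; have /asboolP[n [c [a [aK gE]]]] := gK.
have /choice[x xP] : forall i, exists x, ksec x = a i.
  by move=> i; have [x _ <-] := aK i; exists x.
exists n, c, x => y; rewrite /= gE fct_sumE; apply: eq_bigr => i _.
by rewrite -xP.
Qed.

(** Only [g] is expanded, while [f] enters through its values; independence of the expansion of [g]
    comes from [kdot_swap]. *)
Definition kdot f g : R[i] := xget 0 [set l | exists n c x,
  @kspan_rep g n c x /\ l = \sum_i (c i)^*%R * f (x i)].

(** The left side ignores the expansion of [f] and the right side that of [g], so neither depends on
    the expansion it uses. Both equal the double sum of [conj (c i) * d j * K (x i) (y j)]. *)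
Lemma kdot_swap f g m (d : 'I_m -> R[i]) y n (c : 'I_n -> R[i]) x :
  kspan_rep f d y -> kspan_rep g c x ->
  \sum_i (c i)^*%R * f (x i) = (\sum_j (d j)^*%R * g (y j))^*%R.
Proof.
move=> fE gE; rewrite rmorph_sum/=.
under eq_bigr do rewrite fE mulr_sumr.
rewrite exchange_big/=; apply: eq_bigr => j _.
rewrite rmorphM/= conjCK gE rmorph_sum mulr_sumr; apply: eq_bigr => i _ /=.
by rewrite rmorphM/= pd_kernel_conj; ring.
Qed.

Lemma kdotE f g n (c : 'I_n -> R[i]) x :
  kspan_rep g c x -> kdot f g = \sum_i (c i)^*%R * f (x i).
Proof.
move=> gE; have [m [d [y fE]]] := kspan_repP f.
rewrite /kdot; case: xgetP => [l _ [n' [c' [x' [gE' ->]]]]|noL].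
  by rewrite (kdot_swap fE gE') (kdot_swap fE gE).
by exfalso; apply: (noL _); exists n, c, x; split.
Qed.

Lemma kdotPl a f g h : kdot (a *: f + g) h = a * kdot f h + kdot g h.
Proof.
have [n [c [x hE]]] := kspan_repP h.
rewrite !(kdotE _ hE) mulr_sumr -big_split/=; apply: eq_bigr => i _.
rewrite -[LHS]/((c i)^*%R * (a * f (x i) + g (x i))).
by ring.
Qed.

Lemma kdotC f g : kdot f g = (kdot g f)^*%R.
Proof.
have [n [c [x gE]]] := kspan_repP g; have [m [d [y fE]]] := kspan_repP f.
by rewrite (kdotE _ gE) (kdotE _ fE); exact: kdot_swap.
Qed.

Lemma kdot_ge0 f : 0 <= kdot f f.
Proof.
have [n [c [x fE]]] := kspan_repP f.
rewrite (kdotE _ fE) (le_trans (pd_kernelP K x c))// ler_sum// => i _.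
by rewrite fE mulr_sumr ler_sum// => j _; rewrite mulrA.
Qed.

Lemma kdot_bilinear : bilinear_for *%R (Num.conj \; *%R) kdot.
Proof.
split=> [h a f g|h a f g] /=; first exact: kdotPl.
by rewrite (kdotC h) kdotPl rmorphD rmorphM/= (kdotC h f) (kdotC h g).
Qed.

Lemma kdot_hermitian f g : kdot f g = (-1) ^+ false * (kdot g f)^*%R.
Proof. by rewrite expr0 mul1r kdotC. Qed.

HB.instance Definition _ := bilinear_isBilinear.Build R[i] kspan kspan
  R[i] *%R (Num.conj \; *%R) kdot kdot_bilinear.
HB.instance Definition _ := isHermitianSesquilinear.Build R[i] kspan
  false Num.conj kdot kdot_hermitian.

Lemma ksec_subproof x : ksec x \in is_kspan.
Proof. by apply/asboolP/lin_span_gen; exists x. Qed.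

Definition kspan_sec x : kspan := KSpan (ksec_subproof x).

Lemma kdot_sec f x : kdot f (kspan_sec x) = f x.
Proof.
rewrite (@kdotE _ _ 1 (fun=> 1) (fun=> x)); last first.
  by move=> y; rewrite big_ord1 mul1r.
by rewrite big_ord1 conjC1 mul1r.
Qed.

(** Semidefinite Cauchy-Schwarz against a section bounds [|f x|^2] by [kdot f f * K x x], so a null
    vector vanishes as a function. *)
Lemma kdot_gt0 f : f != 0 -> 0 < kdot f f.
Proof.
rewrite lt_def kdot_ge0 andbT; apply: contra_neq => f0.
apply/val_inj/funext => x /=; apply/eqP.
rewrite -normr_eq0 -sqrf_eq0 -[f x]kdot_sec eq_le exprn_ge0// andbT.
have := @psd_form_CauchySchwarz _ _ kdot kdot_ge0 f (kspan_sec x).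
by rewrite /= f0 mul0r.
Qed.

HB.instance Definition _ := isDotProduct.Build R[i] kspan kdot kdot_gt0.

Definition kspan_dot : {dot kspan for Num.conj} := kdot.

Lemma lin_span_cpl_embed_sec :
  lin_span (range (fun x => cpl_embed kspan_dot (kspan_sec x))) =
  range (cpl_embed kspan_dot).
Proof.
apply/seteqP; split=> [_ [n [c [a [aK ->]]]]|_ [f _ <-]].
  have /choice[x xP] : forall i, exists x,
      cpl_embed kspan_dot (kspan_sec x) = a i.
    by move=> i; have [x _ <-] := aK i; exists x.
  exists (\sum_i c i *: kspan_sec (x i)); rewrite // linear_sum.
  by apply: eq_bigr => i _; rewrite linearZ/= xP.
have [n [c [x fE]]] := kspan_repP f.
exists n, c, (fun i => cpl_embed kspan_dot (kspan_sec (x i))); split.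
  by move=> i; exists (x i).
have -> : f = \sum_i c i *: kspan_sec (x i).
  apply/val_inj; rewrite (linear_sum val); apply/funext => y.
  by rewrite fct_sumE -[LHS]/(f y) fE.
by rewrite linear_sum; apply: eq_bigr => i _; rewrite linearZ.
Qed.

(** [f v = <cpl_embed v, f>] is antilinear in [v], and every [v] is a combination of sections. *)
Lemma kspan_completion_inj :
  injective (fun (f : completion kspan_dot) x => f (kspan_sec x)).
Proof.
move=> f g fg; apply/val_inj/funext => v /=; rewrite -!inner_cpl_embed.
have : lin_span (range (fun x => cpl_embed kspan_dot (kspan_sec x)))
    (cpl_embed kspan_dot v) by rewrite lin_span_cpl_embed_sec; exists v.
move=> [n [c [a [aK ->]]]]; rewrite !inner_suml; apply: eq_bigr => i _.
have [x _ <-] := aK i; rewrite !innerZl !inner_cpl_embed; congr (_ * _).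
by have := congr1 (@^~ x) fg.
Qed.

(** A point of the completion is a functional on [kspan]; restricting it to the sections turns it
    into a function on [X]. *)
Lemma rkhs_inhabited : inhabited (rkhs K).
Proof.
have fun_scalar x : scalar (fun f : completion kspan_dot => f (kspan_sec x)).
  by [].
have sec_fun x :
    (fun y => cpl_embed kspan_dot (kspan_sec x) (kspan_sec y)) = K^~ x.
  apply/funext => y; rewrite -[LHS]/(kdot (kspan_sec x) (kspan_sec y)).
  by rewrite kdot_sec.
have sec_dense : closure (lin_span
    (range (fun x => cpl_embed kspan_dot (kspan_sec x)))) = setT.
  by rewrite lin_span_cpl_embed_sec closure_cpl_embed.
have sec_repr (f : completion kspan_dot) x :
    f (kspan_sec x) = inner (cpl_embed kspan_dot (kspan_sec x)) f.
  by rewrite inner_cpl_embed.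
exact: inhabits
  (Rkhs fun_scalar kspan_completion_inj sec_fun sec_dense sec_repr).
Qed.

End KernelSpan.

(** * The dilation *)

Section CompletelyPositive.
Variables (R : realType) (H : hilbertType R) (phi : {linear 'B(H) -> 'B(H)}).
Hypothesis phi_cp : completely_positive phi.

Lemma cp_gram_ge0 n (T : 'I_n -> 'B(H)) (h : 'I_n -> H) :
  0 <= \sum_i \sum_j inner (h i) (phi (adjoint (T i) * T j) (h j)).
Proof.
pose A : 'M['B(H)]_n := \matrix_(i, j) (adjoint (T i) * T j).
have A_ge0 : mx_op_positive A.
  (* The matrix [T_i^* T_j] has quadratic form [|\sum_i T_i g_i|^2]. *)
  move=> g; rewrite (_ : \sum_i _ =
      inner (\sum_i T i (g i)) (\sum_j T j (g j))); last first.
    rewrite inner_suml; apply: eq_bigr => i _; rewrite adjointPr; congr inner.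
    by rewrite linear_sum; apply: eq_bigr => j _; rewrite mxE.
  by rewrite inner_norm exprn_ge0.
rewrite (le_trans (phi_cp A_ge0 h))// ler_sum// => i _.
by rewrite inner_sumr ler_sum// => j _; rewrite !mxE.
Qed.

Lemma cp_gram_le (S : 'B(H)) (M : R[i]) : (forall u, `|S u| <= M * `|u|) ->
  forall n (T : 'I_n -> 'B(H)) (h : 'I_n -> H),
  \sum_i \sum_j inner (h i) (phi (adjoint (S * T i) * (S * T j)) (h j)) <=
  M ^+ 2 * \sum_i \sum_j inner (h i) (phi (adjoint (T i) * T j) (h j)).
Proof.
move=> SM n T h.
pose A : 'M['B(H)]_n := \matrix_(i, j)
  (M ^+ 2 *: (adjoint (T i) * T j) - adjoint (S * T i) * (S * T j)).
have A_ge0 : mx_op_positive A.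
  (* In terms of [w] the quadratic form is [M^2 |w|^2 - |S w|^2]. *)
  move=> g; pose w := \sum_i T i (g i).
  rewrite (_ : \sum_i _ = M ^+ 2 * inner w w - inner (S w) (S w)).
    rewrite !inner_norm subr_ge0 -exprMn lerXn2r ?nnegrE//.
    exact: le_trans (SM w).
  have -> : S w = \sum_i S (T i (g i)) by rewrite linear_sum.
  rewrite /w !inner_suml mulr_sumr -sumrB; apply: eq_bigr => i _.
  rewrite !inner_sumr mulr_sumr -sumrB; apply: eq_bigr => j _.
  by rewrite mxE bopBE bopZE !bopME innerBr innerZr -!adjointPr.
rewrite -subr_ge0 (le_trans (phi_cp A_ge0 h))// mulr_sumr -sumrB.
rewrite ler_sum// => i _; rewrite inner_sumr mulr_sumr -sumrB ler_sum// => j _.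
rewrite !mxE linearB linearZ/=.
rewrite -[leLHS]/(inner (h i) (M ^+ 2 *: phi (adjoint (T i) * T j) (h j) -
    phi (adjoint (S * T i) * (S * T j)) (h j))).
by rewrite innerBr innerZr.
Qed.

Lemma dilation_kernel_pd : positive_definite_kernel (dilation_kernel phi).
Proof.
move=> n x c.
rewrite (le_trans (cp_gram_ge0 (fun i => (x i).1) (fun i => c i *: (x i).2)))//.
rewrite ler_sum// => i _; rewrite ler_sum// => j _.
by rewrite linearZ/= innerZl innerZr mulrA.
Qed.

End CompletelyPositive.

Section ReproducingKernel.
Variables (R : realType) (X : Type) (K : X -> X -> R[i]) (HK : rkhs K).

Lemma inner_ksection x y : inner (ksection HK x) (ksection HK y) = K x y.
Proof. by rewrite -reproducing ksection_fun. Qed.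

Lemma ksection_gram n (c : 'I_n -> R[i]) (x : 'I_n -> X) :
  `|\sum_i c i *: ksection HK (x i)| ^+ 2 =
    \sum_i \sum_j (c i)^*%R * c j * K (x i) (x j).
Proof.
rewrite -inner_norm inner_suml; apply: eq_bigr => i _.
rewrite inner_sumr; apply: eq_bigr => j _.
by rewrite innerZl innerZr inner_ksection mulrA.
Qed.

Lemma ksection_inner_ext (u v : HK) :
  (forall x, inner (ksection HK x) u = inner (ksection HK x) v) -> u = v.
Proof.
by move=> uv; apply: rkhs_fun_inj; apply/funext => x; rewrite !reproducing.
Qed.

End ReproducingKernel.

Section Dilation.
Variables (R : realType) (H : hilbertType R) (phi : {linear 'B(H) -> 'B(H)}).
Hypothesis phi_cp : completely_positive phi.
Let K := dilation_kernel phi.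
Variable HK : rkhs K.
Let k (T : 'B(H)) (b : H) : HK := ksection HK (T, b).

Lemma ksection_linear_vector T : linear (k T).
Proof.
move=> a u v; apply: ksection_inner_ext => x.
rewrite innerDr innerZr !inner_ksection /K /dilation_kernel/=.
by rewrite linearP innerDr innerZr.
Qed.

Lemma ksection_linear_operator b : linear (k^~ b).
Proof.
move=> a S T; apply: ksection_inner_ext => x.
rewrite innerDr innerZr !inner_ksection /K /dilation_kernel/= mulrDr.
have -> : adjoint x.1 * (a *: S) = a *: (adjoint x.1 * S).
  by apply/val_inj/funext => u /=; rewrite linearZ.
rewrite linearP.
rewrite -[LHS]/(inner x.2
  (a *: phi (adjoint x.1 * S) b + phi (adjoint x.1 * T) b)).
by rewrite innerDr innerZr.
Qed.

Lemma dilation_isometry_bounded : k 1 \in @is_bounded_op R H HK.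
Proof.
apply/asboolP; split; first exact: ksection_linear_vector.
have [M M0 phiM] := bop_bounded (phi (adjoint 1 * 1)).
(* [|V b|^2 = <b, phi 1 b>] is at most [M |b|^2]; the bound [M + 1] works because [M <= (M + 1)^2],
   which avoids a square root. *)
exists (M + 1) => b.
rewrite -(ler_pXn2r (n := 2)) ?nnegrE ?mulr_ge0 ?addr_ge0//.
rewrite -inner_norm inner_ksection /K /dilation_kernel/=.
have Kb0 : 0 <= inner b (phi (adjoint 1 * 1) b).
  rewrite -[leRHS]/(K (1, b) (1, b)) -(inner_ksection HK) inner_norm.
  exact: exprn_ge0.
rewrite -[leLHS]ger0_norm// (le_trans (inner_CauchySchwarz _ _))//.
rewrite (le_trans (ler_wpM2l _ (phiM b)))// mulrCA -expr2 exprMn.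
rewrite ler_wpM2r ?exprn_ge0// expr2 mulrDl mul1r.
rewrite (le_trans _ (_ : M + 1 <= _))//.
  by rewrite lerDl.
by rewrite lerDr mulr_ge0 ?addr_ge0.
Qed.

Definition dilation_V : bop H HK := Bop dilation_isometry_bounded.

Lemma dilation_pi_exists : exists pi : 'B(H) -> 'B(HK),
  forall S T b, pi S (k T b) = k (S * T) b.
Proof.
have /choice[pi piP] : forall S : 'B(H), exists P : 'B(HK),
    forall x, P (ksection HK x) = k (S * x.1) x.2.
  move=> S; have [M M0 SM] := bop_bounded S.
  apply: (bop_dense_extension (ksection_dense HK) M0) => n c x.
  rewrite -(ler_pXn2r (n := 2)) ?nnegrE ?mulr_ge0// exprMn !ksection_gram.
  (* The scalars [c i] are absorbed into the vectors, which gives the form treated by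
     [cp_gram_le]. *)
  have gramE (T : 'I_n -> 'B(H)) :
      \sum_i \sum_j (c i)^*%R * c j * K (T i, (x i).2) (T j, (x j).2) =
      \sum_i \sum_j inner (c i *: (x i).2)
        (phi (adjoint (T i) * T j) (c j *: (x j).2)).
    apply: eq_bigr => i _; apply: eq_bigr => j _.
    by rewrite linearZ/= innerZl innerZr mulrA.
  rewrite (gramE (fun i => S * (x i).1)).
  have := gramE (fun i => (x i).1).
  under eq_bigr do under eq_bigr do rewrite -!surjective_pairing.
  by move=> ->; exact: cp_gram_le.
by exists pi => S T b; rewrite piP.
Qed.

Lemma dilation_pi_unique (pi pi' : 'B(H) -> 'B(HK)) :
  (forall S T b, pi S (k T b) = k (S * T) b) ->
  (forall S T b, pi' S (k T b) = k (S * T) b) -> pi' = pi.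
Proof.
move=> piP pi'P; apply/funext => S; apply: (bop_eq_dense (ksection_dense HK)).
by move=> _ [[T b] _ <-]; rewrite piP pi'P.
Qed.

Variable pi : 'B(H) -> 'B(HK).
Hypothesis piP : forall S T b, pi S (k T b) = k (S * T) b.

Lemma dilation_pi_representation : unital_star_representation pi.
Proof.
split.
- move=> a S T; apply: (bop_eq_dense (ksection_dense HK)) => _ [[U b] _ <-].
  rewrite bopDE bopZE !piP mulrDl -ksection_linear_operator; congr k.
  by congr (_ + _); exact/val_inj.
- apply: (bop_eq_dense (ksection_dense HK)) => _ [[U b] _ <-].
  by rewrite piP mul1r.
- move=> S T; apply: (bop_eq_dense (ksection_dense HK)) => _ [[U b] _ <-].
  by rewrite bopME !piP mulrA.
- move=> S; apply/esym/adjoint_unique => u v.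
  (* Between the sections at [(T, a)] and [(U, b)], both operators give [<a, phi (T^* S U) b>]. *)
  suff -> : pi S = adjoint (pi (adjoint S)) by rewrite -adjointPr.
  apply: (bop_eq_dense (ksection_dense HK)) => _ [[U b] _ <-].
  apply: ksection_inner_ext => -[T a].
  rewrite -adjointPr !piP !inner_ksection /K /dilation_kernel/=.
  by rewrite adjointM adjointK mulrA.
Qed.

Lemma dilation_minimal : minimal_stinespring_dilation phi pi dilation_V.
Proof.
split; first exact: dilation_pi_representation.
- move=> S; apply/val_inj/funext => b; apply: inner_extr => a.
  rewrite -[RHS]/(inner a (adjoint dilation_V (pi S (k 1 b)))).
  rewrite -adjointPr piP mulr1 -[dilation_V a]/(k 1 a) inner_ksection.
  by rewrite /K /dilation_kernel/= adjoint1 mul1r.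
(* [pi S (V b)] is the section at [(S, b)], so the two generating sets coincide. *)
- rewrite -(ksection_dense HK); congr (closure (lin_span _)).
  apply/seteqP; split=> [_ [S _ [b _ <-]]|_ [[S b] _ <-]].
    by exists (S, b); rewrite // -[dilation_V b]/(k 1 b) piP mulr1.
  by exists S => //; exists b => //; rewrite -[dilation_V b]/(k 1 b) piP mulr1.
Qed.

End Dilation.

Theorem theorem2p1 (R : realType) (H : hilbertType R)
    (phi : {linear 'B(H) -> 'B(H)}) (phi_cp : completely_positive phi) :
  let K := dilation_kernel phi in
  positive_definite_kernel K /\
  inhabited (rkhs K) /\
  forall HK : rkhs K,
    exists (V : bop H HK) (pi : 'B(H) -> 'B(HK)),
      [/\ minimal_stinespring_dilation phi pi V,
          forall b : H, V b = ksection HK (1, b),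
          forall (S T : 'B(H)) (b : H),
            pi S (ksection HK (T, b)) = ksection HK (S * T, b)
        & forall pi' : 'B(H) -> 'B(HK),
            (forall (S T : 'B(H)) (b : H),
               pi' S (ksection HK (T, b)) = ksection HK (S * T, b)) ->
            pi' = pi].
Proof.
move=> K; have K_pd : positive_definite_kernel K by exact: dilation_kernel_pd.
split=> //; split; first exact: (rkhs_inhabited (PDKernel K_pd)).
move=> HK; have [pi piP] := dilation_pi_exists phi_cp HK.
exists (dilation_V HK), pi; split=> //; first exact: dilation_minimal.
by move=> pi' pi'P; exact: dilation_pi_unique.
Qed.
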